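(* For $A, B \in M_+(n,\mathbb{C})$, we have $$\int_0^1 A\#_{\nu}B\,d\nu \leq \frac{1}{4} \left\{ \frac{A+B}{2} + \frac{3}{2}\left(A\#_{2/3}B+A\#_{1/3}B\right)\right\} \leq \frac{1}{2} \left(\frac{A+B}{2}+2A\#_{1/2}B\right).$$
   Context: $M_+(n,\mathbb{C})$ is the set of all $n\times n$ positive semidefinite complex matrices. For $0\le\nu\le1$, $A\#_{\nu}B \equiv A^{1/2}(A^{-1/2}BA^{-1/2})^{\nu}A^{1/2}$ is the $\nu$-weighted geometric mean introduced by Kubo and Ando. Inequalities between Hermitian matrices are in the Loewner order ($S\le T$ means $T-S$ is positive semidefinite). Powers are defined by the functional calculus and the integral is taken entrywise. *)

(* Defs.v *)
From mathcomp Require Import all_boot all_order all_algebra.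
From mathcomp Require Import complex.
From mathcomp Require Import all_classical all_reals all_analysis.

Set Implicit Arguments.
Unset Strict Implicit.
Unset Printing Implicit Defensive.

Import Order.TTheory GRing.Theory Num.Theory.
Import numFieldNormedType.Exports.

Local Open Scope classical_set_scope.
Local Open Scope ring_scope.
Local Open Scope complex_scope.
Local Open Scope sesquilinear_scope.

(* On [R[i]], [0 <= z] means that z is real and nonnegative. *)
Definition psdmx (R : realType) (n : nat) (A : 'M[R[i]]_n) : Prop :=
  A \is hermsymmx /\ forall x : 'cV[R[i]]_n, 0 <= (x ^t* *m A *m x) 0 0.

Definition loewner_le (R : realType) (n : nat) (S T : 'M[R[i]]_n) : Prop :=
  psdmx (T - S).

(* Functional calculus for Hermitian matrices: for normal A,
   A = invmx (spectralmx A) *m diag_mx (spectral_diag A) *m spectralmx A with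
   spectralmx A unitary; for Hermitian A the entries of spectral_diag A are
   real, so taking real parts loses nothing. *)
Definition mxfun (R : realType) (n : nat) (f : R -> R) (A : 'M[R[i]]_n)
    : 'M[R[i]]_n :=
  invmx (spectralmx A)
    *m diag_mx (map_mx (fun z : R[i] => (f (complex.Re z))%:C)
                       (spectral_diag A))
    *m spectralmx A.

(* [powR] satisfies 0 `^ 0 = 1, so mxpow A 0 is the identity. *)
Definition mxpow (R : realType) (n : nat) (A : 'M[R[i]]_n) (p : R)
    : 'M[R[i]]_n :=
  mxfun (fun x : R => x `^ p) A.

Definition geomean_unit (R : realType) (n : nat) (nu : R) (A B : 'M[R[i]]_n)
    : 'M[R[i]]_n :=
  mxpow A (2^-1)
    *m mxpow (mxpow A (- 2^-1) *m B *m mxpow A (- 2^-1)) nu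
    *m mxpow A (2^-1).

Definition limmx0 (R : realType) (n : nat) (F : R -> 'M[R[i]]_n)
    : 'M[R[i]]_n :=
  \matrix_(i, j) (lim (complex.Re (F e i j) @[e --> 0^'+])
               +i* lim (complex.Im (F e i j) @[e --> 0^'+])).

(* The formula makes sense when A is invertible. For singular A the
   Kubo-Ando mean is defined by A # B = lim_(e -> 0+) (A + e I) # (B + e I). *)
Definition geomean (R : realType) (n : nat) (nu : R) (A B : 'M[R[i]]_n)
    : 'M[R[i]]_n :=
  if A \in unitmx then geomean_unit nu A B
  else limmx0 (fun e : R => geomean_unit nu (A + (e%:C)%:M) (B + (e%:C)%:M)).

Definition mxintegral01 (R : realType) (n : nat) (F : R -> 'M[R[i]]_n)
    : 'M[R[i]]_n :=
  \matrix_(i, j)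
    ((\int[lebesgue_measure]_(t in `[0%R, 1%R]) complex.Re (F t i j))
  +i* (\int[lebesgue_measure]_(t in `[0%R, 1%R]) complex.Im (F t i j))).

(* Main.v *)
(* Positive semidefinite [A] and [B] are diagonalized simultaneously by a
   congruence, [A = M^* diag(a) M] and [B = M^* diag(b) M] with [M] invertible
   and [a, b >= 0].  Then [A #_nu B = M^* diag(a^(1-nu) b^nu) M] for all [nu] in
   [0, 1], so both inequalities reduce to entrywise scalar ones: Simpson's 3/8
   rule for [nu |-> a^(1-nu) b^nu], that is [sinh(3u)/(3u) <= cosh(u)^3], and a
   polynomial inequality in [a^(1/6)] and [b^(1/6)].

   For invertible [A] the formula holds since functional calculus is unitarily
   invariant.  For singular [A] one squeezes: [c1 M^*M <= 1 <= c2 M^*M] bounds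
   [A + e] and [B + e] between matrices diagonalized by the same [M], and the
   weighted geometric mean is monotone in both arguments.  Monotonicity at the
   midpoint of two weights follows from monotonicity at these weights by an
   eigenvector argument; it therefore holds at dyadic weights, and at all
   weights by continuity. *)
Require Import Defs.
From mathcomp Require Import all_boot all_order all_algebra.
From mathcomp Require Import complex.
From mathcomp Require Import all_classical all_reals all_analysis.
From mathcomp Require Import measurable_realfun ring lra.
Import Order.TTheory GRing.Theory Num.Theory.
Import numFieldNormedType.Exports.
Set Implicit Arguments.
Unset Strict Implicit.
Unset Printing Implicit Defensive.
Local Open Scope ring_scope.
Local Open Scope sesquilinear_scope.

(** Since [powR] gives [0 ^ 0 = 1], the values at the weights 0 and 1 are [a] and [b] even when one
    of the two vanishes; at interior weights the mean is then 0. *)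
Definition wgm (R : realType) (a b nu : R) : R := a `^ (1 - nu) * b `^ nu.

(** * Scalar inequalities *)

Section SinhCosh.
Variable R : realType.
Implicit Types u : R.
Local Open Scope classical_set_scope.

(** Twice the hyperbolic cosine and sine, so that their identities have integer coefficients. *)
Definition cosh2 u := expR u + expR (- u).
Definition sinh2 u := expR u - expR (- u).

Lemma is_derive_expRN u : is_derive u 1 (fun v : R => expR (- v)) (- expR (- u)).
Proof.
have H : is_derive u 1 (-%R : R -> R) (- 1) by exact: is_deriveN.
by have := is_derive1_comp (is_derive_expR (- u)) H; rewrite mulrN1.
Qed.

Lemma is_derive_cosh2 u : is_derive u 1 cosh2 (sinh2 u).
Proof. exact: (@is_deriveD _ _ _ _ _ _ _ _ _ _ (is_derive_expRN u)). Qed.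

Lemma is_derive_sinh2 u : is_derive u 1 sinh2 (cosh2 u).
Proof.
rewrite (_ : cosh2 u = expR u - - expR (- u)); last by rewrite opprK.
exact: (@is_deriveB _ _ _ _ _ _ _ _ _ _ (is_derive_expRN u)).
Qed.

(** By the mean value theorem, [f u = df c * u] for some [c] in []0, u[]. *)
Lemma is_derive_nonneg (f df : R -> R) : (forall u, is_derive u 1 f (df u)) ->
  f 0 = 0 -> (forall u, 0 <= u -> 0 <= df u) -> forall u, 0 <= u -> 0 <= f u.
Proof.
move=> fd f0 d0 u; rewrite le_eqVlt => /predU1P[<-|u0]; first by rewrite f0.
have fc : {within `[0, u], continuous f}.
  apply: continuous_subspaceT => x; apply: differentiable_continuous.
  by apply/derivable1_diffP; case: (fd x).
have [c] := MVT u0 (fun x _ => fd x) fc.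
rewrite in_itv /= => /andP[c0 _]; rewrite f0 !subr0 => ->.
by rewrite mulr_ge0 ?d0 // ltW.
Qed.

Lemma cosh2_sqr u : cosh2 u ^+ 2 = sinh2 u ^+ 2 + 4.
Proof.
have : expR u * expR (- u) = 1 by rewrite -expRD subrr expR0.
rewrite /cosh2 /sinh2; nra.
Qed.

Lemma sinh2_ge0 u : 0 <= u -> 0 <= sinh2 u.
Proof. by move=> u0; rewrite /sinh2 subr_ge0 ler_expR; lra. Qed.

(** This is [tanh u <= u]: the difference vanishes at 0 and has derivative [u * sinh2 u]. *)
Lemma sinh2_le_mul_cosh2 u : 0 <= u -> 0 <= u * cosh2 u - sinh2 u.
Proof.
move: u; apply: (@is_derive_nonneg _ (fun u => u * sinh2 u)) => [u||u u0].
- have H := is_deriveB (is_deriveM (is_derive_id u 1) (is_derive_cosh2 u))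
    (is_derive_sinh2 u).
  apply: (is_derive_eq H); rewrite /GRing.scale /=; ring.
- by rewrite mul0r /sinh2 oppr0 subrr subr0.
- by rewrite mulr_ge0 // sinh2_ge0.
Qed.

(** By the triple angle formula the difference of the two sides is [3 u c^3 - 4 (s^3 + 3 s)] with
    [c = cosh2 u] and [s = sinh2 u]. It vanishes at 0, and its derivative factors as
    [9 c s (u c - s)]. *)
Lemma sinh3_le_cosh_cube u : 0 <= u ->
  4 * (expR (3 * u) - expR (- (3 * u))) <= 3 * u * (expR u + expR (- u)) ^+ 3.
Proof.
move=> u0; rewrite -subr_ge0.
have E3 (v : R) : expR (3 * v) = expR v ^+ 3 by rewrite mulrC expRM_natr.
rewrite -(mulrN 3 u) !E3.
have EE : expR u * expR (- u) = 1 by rewrite -expRD subrr expR0.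
have -> : expR u ^+ 3 - expR (- u) ^+ 3 = sinh2 u ^+ 3 + 3 * sinh2 u.
  have -> : 3 * sinh2 u = 3 * (expR u * expR (- u)) * sinh2 u.
    by rewrite EE mulr1.
  by rewrite /sinh2; ring.
rewrite -/(cosh2 u) {EE}; move: u u0.
apply: (@is_derive_nonneg _
  (fun u => 9 * cosh2 u * sinh2 u * (u * cosh2 u - sinh2 u))).
- move=> u.
  have H := is_deriveB
    (is_deriveM (is_deriveM (is_derive_cst (3 : R) u 1) (is_derive_id u 1))
      (is_deriveX 3 (is_derive_cosh2 u)))
    (is_deriveM (is_derive_cst (4 : R) u 1)
      (is_deriveD (is_deriveX 3 (is_derive_sinh2 u))
        (is_deriveM (is_derive_cst (3 : R) u 1) (is_derive_sinh2 u)))).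
  apply: (is_derive_eq H); rewrite /GRing.scale /= !mulr0 !addr0 mulr1.
  change (3 * u * (3 * cosh2 u ^+ 2 * sinh2 u) + cosh2 u * cosh2 u ^+ 2 * 3 -
    4 * (3 * sinh2 u ^+ 2 * cosh2 u + 3 * cosh2 u) =
    9 * cosh2 u * sinh2 u * (u * cosh2 u - sinh2 u)).
  (* Only the square in the cubic term is replaced by [sinh2 u ^+ 2 + 4]; what remains is a
     polynomial identity. *)
  rewrite [cosh2 u * cosh2 u ^+ 2]mulrC [X in X * cosh2 u * 3]cosh2_sqr; ring.
- by rewrite /sinh2 oppr0 subrr; ring.
- move=> u u0; rewrite mulr_ge0 ?sinh2_le_mul_cosh2 //.
  rewrite mulr_ge0 ?sinh2_ge0 // mulr_ge0 //.
  by rewrite addr_ge0 // expR_ge0.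
Qed.

End SinhCosh.

(** * Scalar weighted means: continuity, integral and the two inequalities *)

Section ScalarMeans.
Variable R : realType.
Implicit Types (a b c d u nu : R).
Local Notation mu := (@lebesgue_measure R).
Local Open Scope classical_set_scope.

Lemma powRVhalfK a : 0 < a -> a `^ (2^-1) * a `^ (- 2^-1) = 1.
Proof.
move=> a0; rewrite -powRD ?subrr ?powRr0 //.
by apply/implyP => _; rewrite gt_eqF.
Qed.

Lemma powRhalf2 a : 0 <= a -> a `^ (2^-1) * a `^ (2^-1) = a.
Proof.
move=> a0; rewrite -powRD; last by apply/implyP => /eqP; lra.
by rewrite (_ : _ + _ = 1) ?powRr1 //; lra.
Qed.

Lemma wgm_gt0 a b nu : 0 < a -> 0 < b -> 0 < wgm a b nu.
Proof. by move=> a0 b0; rewrite mulr_gt0 // powR_gt0. Qed.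

(** The logarithm of [wgm a b] is affine in the weight. This supplies the hypotheses
    [r ^+ 2 = a * b] under which the matrix comparison passes to midpoints of weights. *)
Lemma wgm_mid a b s t : 0 < a -> 0 < b ->
  wgm a b ((s + t) / 2) ^+ 2 = wgm a b s * wgm a b t.
Proof.
move=> a0 b0; rewrite /wgm exprMn [RHS]mulrACA -!powR_mulrn ?powR_ge0 //.
rewrite -!powRrM -!powRD ?(gt_eqF a0) ?(gt_eqF b0) ?implybT //.
by congr (_ `^ _ * _ `^ _); lra.
Qed.

Lemma wgm0 a b : 0 <= a -> wgm a b 0 = a.
Proof. by move=> a0; rewrite /wgm subr0 powRr1 // powRr0 mulr1. Qed.

Lemma wgm1 a b : 0 <= b -> wgm a b 1 = b.
Proof. by move=> a0; rewrite /wgm subrr powRr0 powRr1 // mul1r. Qed.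

(** Positivity matters at the ends: for [a = 0 < b] the function jumps at weight 1. *)
Lemma wgm_continuous a b : 0 < a -> 0 < b -> continuous (wgm a b).
Proof.
move=> a0 b0 nu; rewrite /wgm /powR (gt_eqF a0) (gt_eqF b0).
apply: cvgM; apply: continuous_comp; try exact: continuous_expR.
  apply: cvgM; last exact: cvg_cst.
  by apply: cvgB; [exact: cvg_cst|exact: cvg_id].
by apply: cvgM; [exact: cvg_id|exact: cvg_cst].
Qed.

(** For [p = 0] everything is constantly 1; for [y = 0] the power splits as [e ^ p * c ^ p] and
    tends to 0; for [y > 0] the exponential and the logarithm are continuous. *)
Lemma powR_shift_cvg (y c p : R) : 0 <= y -> 0 < c -> 0 <= p ->
  (y + e * c) `^ p @[e --> 0^'+] --> y `^ p.
Proof.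
move=> y0 c0; rewrite le_eqVlt => /predU1P[<-|p0].
  rewrite powRr0; under eq_fun do rewrite powRr0; exact: cvg_cst.
move: y0; rewrite le_eqVlt => /predU1P[<-|y0].
  rewrite powR0 ?gt_eqF //; apply: (@cvg_trans _ (e `^ p * c `^ p @[e --> 0^'+])).
    by apply: near_eq_cvg; near=> e; rewrite add0r powRM // ltW.
  have h : e `^ p * c `^ p @[e --> 0^'+] --> 0 * c `^ p.
    by apply: cvgM; [exact: powR_cvg0|exact: cvg_cst].
  by move: h; rewrite mul0r.
have yE : y + e * c @[e --> 0^'+] --> y.
  rewrite -[X in _ --> X]addr0 -[X in _ --> y + X](mul0r c).
  apply: cvg_at_right_filter; apply: cvgD; first exact: cvg_cst.
  by apply: cvgM; [exact: cvg_id|exact: cvg_cst].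
apply: (@cvg_trans _ (expR (p * ln (y + e * c)) @[e --> 0^'+])).
  apply: near_eq_cvg; near=> e; rewrite /powR gt_eqF // addr_gt0 //.
  by rewrite mulr_gt0.
rewrite /powR gt_eqF //; apply: continuous_cvg; first exact: continuous_expR.
apply: cvgM; first exact: cvg_cst.
by apply: continuous_cvg => //; exact: continuous_ln.
Unshelve. all: by end_near. Qed.

Lemma Rintegral_expR_affine c d : d != 0 ->
  \int[mu]_(x in `[0, 1]) expR (c + d * x) = (expR (c + d) - expR c) / d.
Proof.
move=> d0; pose F x := expR (c + d * x) / d.
have Fd (x : R) : is_derive x 1 F (expR (c + d * x)).
  have H1 := is_deriveD (is_derive_cst c x 1)
    (is_deriveM (is_derive_cst d x 1) (is_derive_id x 1)).
  have H := is_deriveM (is_derive1_comp (is_derive_expR _) H1)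
    (is_derive_cst (d^-1) x 1).
  apply: (is_derive_eq H).
  rewrite /GRing.scale /= !mulr0 !add0r addr0 mulr1.
  change (d^-1 * (expR (c + d * x) * d) = expR (c + d * x)).
  by rewrite mulrC mulfK.
have Fc : continuous F.
  move=> x; apply: differentiable_continuous.
  by apply/derivable1_diffP; case: (Fd x).
have fc : continuous (fun x => expR (c + d * x)).
  move=> x; apply: continuous_comp; last exact: continuous_expR.
  apply: cvgD; first exact: cvg_cst.
  by apply: cvgM; [exact: cvg_cst|exact: cvg_id].
rewrite /Rintegral (@continuous_FTC2 R _ F) //.
- by rewrite /F mulr1 mulr0 addr0 /= -mulrBl.
- exact: continuous_subspaceT.
- split; first by move=> x _; case: (Fd x).
  + exact/cvg_at_right_filter/Fc.
  + exact/cvg_at_left_filter/Fc.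
- by move=> x _; rewrite derive1E; case: (Fd x).
Qed.

(** Both sides are even in [u], so the case [u > 0] suffices. *)
Lemma sinh3_div_le u : u != 0 ->
  (expR (3 * u) - expR (- (3 * u))) / (6 * u) <= (expR u + expR (- u)) ^+ 3 / 8.
Proof.
have pos (v : R) : 0 < v ->
    (expR (3 * v) - expR (- (3 * v))) / (6 * v) <=
    (expR v + expR (- v)) ^+ 3 / 8.
  move=> v0; rewrite ler_pdivrMr ?mulr_gt0 //.
  by have := sinh3_le_cosh_cube (ltW v0); lra.
have [u0 _|u0 _|//] := ltgtP u 0; last exact: pos.
have := pos (- u); rewrite oppr_gt0 => /(_ u0).
rewrite mulrN !opprK mulrN invrN mulrN -mulNr opprB [expR (- u) + _]addrC //.
Qed.

(** A crude bound, uniform in the weight, that serves for integrability. *)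
Lemma powR_le1D a nu : 0 <= a -> 0 <= nu <= 1 -> a `^ nu <= 1 + a.
Proof.
move=> a0 /andP[nu0 nu1]; have [a1|a1] := leP 1 a.
  apply: (@le_trans _ _ (a `^ 1)); first exact: ler_powR.
  by rewrite powRr1 // lerDr.
apply: (@le_trans _ _ 1); last by rewrite lerDl.
move: a0; rewrite le_eqVlt => /predU1P[<-|a0].
  by rewrite /powR eqxx lern1 leq_b1.
by rewrite -(powRr0 a) ger_powR // a0 ltW.
Qed.

(** The integrand jumps at an endpoint when exactly one of [a] and [b] is 0, so the argument uses
    measurability and boundedness in place of continuity. *)
Lemma integrable_powR_mean a b : 0 <= a -> 0 <= b ->
  mu.-integrable `[0, 1] (EFin \o wgm a b).
Proof.
move=> a0 b0; apply: measurable_bounded_integrable => //=.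
- by rewrite lebesgue_measure_itv /= lte01 sube0 ltry.
- apply: measurable_funM.
    apply: measurableT_comp; first exact: measurable_powRr.
    by apply: measurable_funB.
  by apply: measurable_funTS; exact: measurable_powRr.
- exists ((1 + a) * (1 + b)); split; first exact: num_real.
  move=> x hx nu /=; rewrite in_itv /= => /andP[nu0 nu1].
  apply: le_trans (ltW hx); rewrite ger0_norm ?mulr_ge0 ?powR_ge0 //.
  by apply: ler_pM; rewrite ?powR_ge0 // powR_le1D //; lra.
Qed.

Lemma Rintegral_powR_mean_eq0 a b : (a == 0) || (b == 0) -> 0 <= a -> 0 <= b ->
  \int[mu]_(nu in `[0, 1]) wgm a b nu = 0.
Proof.
move=> ab0 a0 b0; have fi := integrable_powR_mean a0 b0.
(* Both endpoints are removed, because [0 ^ 0 = 1] can make the integrand nonzero there. *)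
rewrite -Rintegral_itv_bndo_bndc; last first.
  by apply: integrableS fi => //; apply: subset_itvl; rewrite bnd_simp.
rewrite -Rintegral_itv_obnd_cbnd; last first.
  by apply: integrableS fi => //; apply: subset_itv; rewrite bnd_simp.
rewrite (@eq_Rintegral _ _ _ mu _ (cst 0)).
  by rewrite Rintegral_cst // mul0r.
move=> nu; rewrite inE /= in_itv /= => /andP[nu0 nu1].
rewrite /wgm; case/orP: ab0 => /eqP ->; rewrite powR0 ?mul0r ?mulr0 // ?gt_eqF //.
by rewrite subr_gt0.
Qed.

(** Relative to the geometric mean [expR s], the right-hand side is [cosh(u)^3], by expanding the
    cube, and the integral is [sinh(3u)/(3u)], or 1 when [u = 0]. *)
Lemma Rintegral_powR_mean_gt0 a b : 0 < a -> 0 < b ->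
  \int[mu]_(nu in `[0, 1]) wgm a b nu <=
  (a + b + 3 * (wgm a b (2 / 3) + wgm a b (1 / 3))) / 8.
Proof.
(* The sixth of the logarithmic ratio places the weights 0, 1/3, 2/3, 1 at [-3u], [-u], [u],
   [3u]. *)
move=> a0 b0; pose s := (ln a + ln b) / 2; pose u := (ln b - ln a) / 6.
have mE nu : wgm a b nu = expR s * expR ((6 * nu - 3) * u).
  by rewrite /wgm /powR !gt_eqF // -!expRD; congr expR; rewrite /s /u; field.
have aE : a = expR s * expR (- (3 * u)).
  by rewrite -{1}[a]lnK // -expRD; congr expR; rewrite /s /u; field.
have bE : b = expR s * expR (3 * u).
  by rewrite -{1}[b]lnK // -expRD; congr expR; rewrite /s /u; field.
clearbody s u.
have E3 (v : R) : expR (3 * v) = expR v ^+ 3 by rewrite mulrC expRM_natr.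
have -> : (a + b + 3 * (wgm a b (2 / 3) +
    wgm a b (1 / 3))) / 8 = expR s * ((expR u + expR (- u)) ^+ 3 / 8).
  rewrite !mE {1}aE {1}bE -(mulrN 3 u) !E3.
  rewrite (_ : (6 * (2 / 3) - 3) * u = u); last by field.
  rewrite (_ : (6 * (1 / 3) - 3) * u = - u); last by field.
  have EE : expR u * expR (- u) = 1 by rewrite -expRD subrr expR0.
  have -> : (expR u + expR (- u)) ^+ 3 = expR u ^+ 3 + expR (- u) ^+ 3 +
      3 * (expR u * expR (- u)) * (expR u + expR (- u)) by ring.
  by rewrite EE; field.
rewrite (@eq_Rintegral _ _ _ mu _
    (fun nu => expR ((s - 3 * u) + (6 * u) * nu))) => [|nu _]; last first.
  by rewrite mE -expRD; congr expR; ring.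
(* For [u = 0] the integrand is constant, and the antiderivative would divide by [6 * u]. *)
have [u0|u0] := eqVneq u 0.
  rewrite (@eq_Rintegral _ _ _ mu _ (cst (expR s))) => [|nu _]; last first.
    by rewrite u0 !mulr0 subr0 mul0r addr0.
  rewrite Rintegral_cst //= lebesgue_measure_itv /= lte01 sube0 /=.
  rewrite mulr1 u0 oppr0 expR0; lra.
rewrite Rintegral_expR_affine ?mulf_neq0 ?pnatr_eq0 //.
rewrite (_ : s - 3 * u + 6 * u = s + 3 * u); last by ring.
rewrite !expRD -mulrBr -mulrA ler_pM2l ?expR_gt0 //.
exact: sinh3_div_le.
Qed.

Lemma Rintegral_powR_mean_le a b : 0 <= a -> 0 <= b ->
  \int[mu]_(nu in `[0, 1]) wgm a b nu <=
  (a + b + 3 * (wgm a b (2 / 3) + wgm a b (1 / 3))) / 8.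
Proof.
move=> a0 b0; have [ab0|] := boolP ((a == 0) || (b == 0)).
  rewrite Rintegral_powR_mean_eq0 // divr_ge0 // !addr_ge0 ?mulr_ge0 //.
  by rewrite addr_ge0 // mulr_ge0 // powR_ge0.
rewrite negb_or => /andP[an0 bn0].
by apply: Rintegral_powR_mean_gt0; rewrite lt_neqAle eq_sym ?an0 ?bn0.
Qed.

(* In terms of [p = a^(1/6)] and [q = b^(1/6)] the difference of the two sides is
   [(t ^ 3 - 6 m ^ 2 t + 8 m ^ 3) / 8] with [t = p ^ 2 + q ^ 2 >= 2 m = 2 p q]. *)
Lemma powR_means_le a b : 0 <= a -> 0 <= b ->
  (a + b + 3 * (wgm a b (2 / 3) + wgm a b (1 / 3))) / 8
  <= (a + b) / 4 + wgm a b (1 / 2).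
Proof.
move=> a0 b0; pose p := a `^ (1 / 6); pose q := b `^ (1 / 6).
have pw (y r : R) (k : nat) : 0 <= y -> r = 1 / 6 * k%:R ->
    y `^ r = (y `^ (1 / 6)) ^+ k.
  by move=> y0 ->; rewrite powRrM powR_mulrn // powR_ge0.
have aE : a = p ^+ 6 by rewrite -(pw _ 1) ?powRr1 //; field.
have bE : b = q ^+ 6 by rewrite -(pw _ 1) ?powRr1 //; field.
rewrite /wgm (pw a (1 - 2 / 3) 2) //; last by field.
rewrite (pw b (2 / 3) 4) //; last by field.
rewrite (pw a (1 - 1 / 3) 4) //; last by field.
rewrite (pw b (1 / 3) 2) //; last by field.
rewrite (pw a (1 - 1 / 2) 3) //; last by field.
rewrite (pw b (1 / 2) 3) //; last by field.
rewrite -/p -/q {1 2}aE {1 2}bE.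
have p0 : 0 <= p by exact: powR_ge0.
have q0 : 0 <= q by exact: powR_ge0.
pose m := p * q; pose t := p ^+ 2 + q ^+ 2.
have m0 : 0 <= m by exact: mulr_ge0.
have tm : 0 <= t - 2 * m.
  by rewrite (_ : _ - _ = (p - q) ^+ 2) ?sqr_ge0 // /t /m; ring.
have key : 0 <= t ^+ 3 - 6 * m ^+ 2 * t + 8 * m ^+ 3.
  (* Expansion around [t = 2 m]: all coefficients in powers of [t - 2 * m] are nonnegative. *)
  rewrite (_ : _ + _ = (t - 2 * m) * ((t - 2 * m) ^+ 2 + 6 * m * (t - 2 * m) +
    6 * m ^+ 2) + 4 * m ^+ 3).
    apply: addr_ge0; last by rewrite mulr_ge0 ?exprn_ge0.
    apply: mulr_ge0 => //; apply: addr_ge0; last by rewrite mulr_ge0 ?exprn_ge0.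
    by apply: addr_ge0; [exact: exprn_ge0|rewrite !mulr_ge0].
  by ring.
rewrite -subr_ge0 (_ : _ - _ = (t ^+ 3 - 6 * m ^+ 2 * t + 8 * m ^+ 3) / 8).
  by rewrite divr_ge0.
by rewrite /t /m; field.
Qed.

End ScalarMeans.

(** * Properties of weights that are stable under midpoints *)

Section DyadicConvexity.
Variable R : realType.

(** Induction on the level: an even numerator cancels a factor 2, and an odd one [2 m + 1] gives the
    midpoint of the neighbours [m] and [m + 1] one level below. *)
Lemma midpoint_dyadic (P : R -> Prop) : P 0 -> P 1 ->
  (forall s t, P s -> P t -> P ((s + t) / 2)) ->
  forall n k : nat, (k <= 2 ^ n)%N -> P (k%:R / 2 ^+ n).
Proof.
move=> P0 P1 Pmid; elim=> [|n IH] k.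
  rewrite expn0 expr0 divr1; case: k => [|[|]] //.
rewrite expnS mul2n; move: (odd_double_half k) => /=.
move: (odd k) k./2 => [] m <-; rewrite ?add1n ?add0n => mn.
  rewrite (_ : _ / _ = (m%:R / 2 ^+ n + m.+1%:R / 2 ^+ n) / 2).
    apply: Pmid; apply: IH; first by rewrite -leq_double ltnW.
    by rewrite -ltn_double.
  rewrite -mulrDl -mulrA -invfM -exprSr -natrD; congr (_%:R / _).
  by rewrite addnS addnn.
rewrite (_ : _ / _ = m%:R / 2 ^+ n); first by apply: IH; rewrite -leq_double.
by rewrite -muln2 natrM exprS invfM mulrA mulfK.
Qed.

Local Open Scope classical_set_scope.

(** Truncating [x] to [n] binary digits gives a dyadic number within [2^-n] below [x]. *)
Lemma midpoint_seq (P : R -> Prop) : P 0 -> P 1 ->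
  (forall s t, P s -> P t -> P ((s + t) / 2)) ->
  forall x : R, 0 <= x <= 1 -> exists2 u : R^nat, (forall n, P (u n)) & u @ \oo --> x.
Proof.
move=> P0 P1 Pmid x /andP[x0 x1].
pose k n := Num.truncn (x * 2 ^+ n).
have kP n : (k n)%:R <= x * 2 ^+ n < (k n).+1%:R.
  by apply: truncn_itv; rewrite mulr_ge0.
exists (fun n => (k n)%:R / 2 ^+ n) => [n|].
  apply: midpoint_dyadic => //; rewrite -(ler_nat R) natrX.
  have /andP[/le_trans -> //] := kP n.
  by rewrite ler_piMl.
apply: (@squeeze_cvgr _ _ _ _ (fun n => x - 2^-1 ^+ n) (cst x)); last exact: cvg_cst.
  near=> n; have /andP[k1 k2] := kP n.
  rewrite ler_pdivrMr ?exprn_gt0 // k1 andbT.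
  rewrite ler_pdivlMr ?exprn_gt0 // mulrBl -exprMn mulVf // expr1n.
  by rewrite lerBlDr natr1 ltW.
rewrite -[X in _ --> X]subr0; apply: cvgB; first exact: cvg_cst.
by apply: cvg_expr; rewrite ger0_norm ?invr_ge0 // invf_lt1 // ltr1n.
Unshelve. all: by end_near. Qed.

End DyadicConvexity.


(** * Congruence-diagonal matrices *)

Section CongruenceDiag.
Variables (C : numClosedFieldType) (n : nat).
Implicit Types (M N U V W X Y : 'M[C]_n) (a b d e : 'I_n -> C) (x : 'cV[C]_n).

Definition diagf d : 'M[C]_n := diag_mx (\row_i d i).
(** A congruence by an arbitrary [M], so in general the [d i] are not eigenvalues; they are when [M]
    is unitary. *)
Definition congd M d : 'M[C]_n := M^t* *m diagf d *m M.
Definition qform X x : C := (x^t* *m X *m x) 0 0.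
(** The counterpart of [psdmx] over any [numClosedFieldType]; over [R[i]] the two are
    convertible. *)
Definition psd X : Prop :=
  X \is hermsymmx /\ forall x, 0 <= (x ^t* *m X *m x) 0 0.

Lemma diagfE d i j : diagf d i j = d i *+ (i == j).
Proof. by rewrite !mxE. Qed.

Lemma mulmx_adj (m p q : nat) (X : 'M[C]_(m, p)) (Y : 'M[C]_(p, q)) :
  (X *m Y)^t* = Y^t* *m X^t*.
Proof. by rewrite trmx_mul map_mxM. Qed.

Lemma adj_unit M : (M^t* \in unitmx) = (M \in unitmx).
Proof. by rewrite map_unitmx unitmx_tr. Qed.

Lemma diagf_adj d : (forall i, d i \is Num.real) -> (diagf d)^t* = diagf d.
Proof.
move=> dr; apply/matrixP => i j; rewrite !mxE rmorphMn /= eq_sym.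
by case: eqP => [->|]; rewrite (CrealP (dr _)).
Qed.

Lemma diagfM a b : diagf a *m diagf b = diagf (fun i => a i * b i).
Proof.
by rewrite /diagf mulmx_diag; congr diag_mx; apply/rowP => i; rewrite !mxE.
Qed.

Lemma diagf1 : diagf (fun=> 1) = 1%:M.
Proof. by apply/matrixP => i j; rewrite diagfE !mxE. Qed.

Lemma diagf_unit d : (forall i, d i != 0) -> diagf d \in unitmx.
Proof.
move=> d0; have : diagf d *m diagf (fun i => (d i)^-1) = 1%:M.
  by rewrite diagfM -diagf1; congr diagf; apply/funext => i; rewrite divff.
by case/mulmx1_unit.
Qed.

Lemma congdE M d i j : congd M d i j = \sum_k d k * ((M k i)^* * M k j).
Proof.
rewrite /congd /diagf mul_mx_diag !mxE; apply: eq_bigr => k _.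
by rewrite !mxE mulrAC mulrC.
Qed.

Lemma eq_congd M a b : a =1 b -> congd M a = congd M b.
Proof. by move=> ab; congr congd; exact/funext. Qed.

Lemma congd_adj M d : (forall i, d i \is Num.real) -> (congd M d)^t* = congd M d.
Proof. by move=> dr; rewrite /congd !mulmx_adj diagf_adj // trmxCK mulmxA. Qed.

Lemma hermP X : reflect (X^t* = X) (X \is hermsymmx).
Proof.
by apply: (iffP (is_hermitianmxP _ _ _)); rewrite expr0 scale1r => {1}<-.
Qed.

Lemma congdM M N d : N^t* *m congd M d *m N = congd (M *m N) d.
Proof. by rewrite /congd mulmx_adj !mulmxA. Qed.

Lemma congd_diagf M e d : (forall i, e i \is Num.real) ->
  congd (diagf e *m M) d = congd M (fun i => e i ^+ 2 * d i).
Proof.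
move=> er; rewrite -congdM /congd diagf_adj // !diagfM.
by congr (_ *m diagf _ *m _); apply/funext => i; rewrite mulrAC expr2.
Qed.

Lemma congd1 M : congd M (fun=> 1) = M^t* *m M.
Proof. by rewrite /congd diagf1 mulmx1. Qed.

Lemma congd1m d : congd 1%:M d = diagf d.
Proof. by rewrite /congd trmx1 map_mx1 mul1mx mulmx1. Qed.

Lemma congd_unit_neq0 M d i : congd M d \in unitmx -> d i != 0.
Proof.
rewrite /congd !unitmx_mul => /andP[/andP[_]].
rewrite unitmxE det_diag unitfE => /prodf_neq0/(_ i isT).
by rewrite mxE.
Qed.

Lemma congdD M a b : congd M a + congd M b = congd M (fun i => a i + b i).
Proof.
apply/matrixP => i j; rewrite mxE !congdE -big_split /=.
by apply: eq_bigr => k _; rewrite mulrDl.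
Qed.

Lemma congdZ M c d : c *: congd M d = congd M (fun i => c * d i).
Proof.
apply/matrixP => i j; rewrite mxE !congdE mulr_sumr.
by apply: eq_bigr => k _; rewrite mulrA.
Qed.

Lemma congdB M a b : congd M a - congd M b = congd M (fun i => a i - b i).
Proof.
rewrite -scaleN1r congdZ congdD.
by apply: eq_congd => i; rewrite mulN1r.
Qed.

Lemma qform_congd M d x :
  qform (congd M d) x = \sum_k d k * `|(M *m x) k 0| ^+ 2.
Proof.
rewrite /qform /congd -!mulmxA mulmxA -mulmx_adj mulmxA.
rewrite /diagf mul_mx_diag mxE; apply: eq_bigr => k _.
by rewrite normCK !mxE mulrAC mulrC [_^*%R * _]mulrC.
Qed.

Lemma qform_conj X Y x : qform (Y^t* *m X *m Y) x = qform X (Y *m x).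
Proof. by rewrite /qform mulmx_adj !mulmxA. Qed.

Lemma qformD X Y x : qform (X + Y) x = qform X x + qform Y x.
Proof. by rewrite /qform mulmxDr mulmxDl mxE. Qed.

Lemma qformB X Y x : qform (X - Y) x = qform X x - qform Y x.
Proof. by rewrite /qform mulmxBr mulmxBl mxE [in X in _ + X]mxE. Qed.

(** Polarization: the choices 0, 1 and ['i] for [c] recover the entries of [X] from its quadratic
    form. *)
Lemma qform_delta2 X i j c :
  qform X (delta_mx i 0 + c *: delta_mx j 0) =
  X i i + c * c^* * X j j + (c * X i j + c^* * X j i).
Proof.
have dE (k l : 'I_n) :
    ((delta_mx k 0 : 'cV[C]_n)^t* *m X *m (delta_mx l 0 : 'cV[C]_n)) 0 0 = X k l.
  by rewrite trmx_delta map_delta_mx -rowE -colE !mxE.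
have -> : qform X (delta_mx i 0 + c *: delta_mx j 0) =
    (((delta_mx i 0 : 'cV[C]_n)^t* + c^* *: (delta_mx j 0 : 'cV[C]_n)^t*) *m X
    *m (delta_mx i 0 + c *: (delta_mx j 0 : 'cV[C]_n))) 0 0.
  rewrite /qform; congr ((_ *m _ *m _) 0 0).
  by apply/matrixP => k l; rewrite !mxE rmorphD rmorphM.
rewrite !(mulmxDl, mulmxDr).
have addE (Y Z : 'M[C]_1) : (Y + Z) 0 0 = Y 0 0 + Z 0 0 by rewrite mxE.
have scaleE y (Z : 'M[C]_1) : (y *: Z) 0 0 = y * Z 0 0 by rewrite mxE.
rewrite -!scalemxAl -!scalemxAr !(addE, scaleE) !dE; ring.
Qed.

Lemma qform_delta X i : qform X (delta_mx i 0) = X i i.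
Proof. by have := qform_delta2 X i i 0; rewrite scale0r conjC0 !mul0r !addr0. Qed.

Lemma qform_deltaD X i j :
  qform X (delta_mx i 0 + delta_mx j 0) = X i i + X j j + (X i j + X j i).
Proof.
by have := qform_delta2 X i j 1; rewrite scale1r conjC1 !mul1r.
Qed.

Lemma qform_deltaDi X i j : qform X (delta_mx i 0 + 'i *: delta_mx j 0) =
  X i i + X j j + 'i * (X i j - X j i).
Proof.
rewrite qform_delta2 conjCi mulrN -expr2 sqrCi opprK mul1r.
by rewrite mulrBr mulNr.
Qed.

Lemma psd_congd M d : (forall i, 0 <= d i) -> psd (congd M d).
Proof.
move=> d0; split; first by apply/hermP/congd_adj => i; rewrite ger0_real.
move=> x; rewrite -/(qform _ _) qform_congd; apply: sumr_ge0 => k _.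
by rewrite mulr_ge0 // exprn_ge0.
Qed.

Lemma psd_conj X Y : psd X -> psd (Y^t* *m X *m Y).
Proof.
move=> [/hermP hX pX]; split.
  by apply/hermP; rewrite !mulmx_adj trmxCK hX mulmxA.
by move=> x; have := pX (Y *m x); rewrite mulmx_adj !mulmxA.
Qed.

Lemma psdD X Y : psd X -> psd Y -> psd (X + Y).
Proof.
move=> [/hermP hX pX] [/hermP hY pY]; split.
  by apply/hermP; rewrite linearD /= map_mxD hX hY.
by move=> x; rewrite -/(qform _ _) qformD addr_ge0 ?pX ?pY.
Qed.

Lemma qform_diag_eigen U d i : U \is unitarymx ->
  qform (congd U d) (U^t* *m delta_mx i 0) = d i.
Proof.
move=> Uu; rewrite -[U in congd U]mul1mx -congdM qform_conj mulmxA.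
by rewrite (unitarymxP Uu) mul1mx qform_delta congd1m diagfE eqxx.
Qed.

Lemma unitary_diag_congd U (D : 'rV[C]_n) : U \is unitarymx ->
  invmx U *m diag_mx D *m U = congd U (fun i => D 0 i).
Proof.
move=> Uu; rewrite invmx_unitary // /congd; congr (_ *m diag_mx _ *m _).
by apply/rowP => i; rewrite !mxE.
Qed.

Lemma herm_spectral X : X \is hermsymmx ->
  let d := fun i => spectral_diag X 0 i in
  [/\ spectralmx X \is unitarymx, forall i, d i \is Num.real &
      X = congd (spectralmx X) d].
Proof.
move=> hX /=; have Uu := spectral_unitarymx X; split=> //.
  by move=> i; exact/mxOverP/hermitian_spectral_diag_real.
have /orthomx_spectralP {1}-> := hermitian_normalmx hX.
exact: unitary_diag_congd.
Qed.

Lemma psd_spectral_ge0 X i : psd X -> 0 <= spectral_diag X 0 i.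
Proof.
move=> [hX pX]; have [Uu _ EX] := herm_spectral hX.
rewrite -[leRHS](@qform_diag_eigen _ (fun k => spectral_diag X 0 k) _ Uu) -EX.
exact: pX.
Qed.

Lemma congd_mul U a b : U \is unitarymx ->
  congd U a *m congd U b = congd U (fun i => a i * b i).
Proof.
move=> Uu; rewrite /congd -diagfM !mulmxA; congr (_ *m _ *m _).
by rewrite mulmxtVK.
Qed.

(* [N *m invmx M] is unitary and intertwines the two diagonals, so its nonzero
   entries link equal diagonal values. *)
Lemma congd_fun_uniq M N d e (f : C -> C) : M \in unitmx -> N \in unitmx ->
  congd M (fun=> 1) = congd N (fun=> 1) -> congd M d = congd N e ->
  congd M (f \o d) = congd N (f \o e).
Proof.
move=> Mu Nu; rewrite !congd1 => E1 E2.
pose W := N *m invmx M.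
have NE : N = W *m M by rewrite mulmxKV.
clearbody W.
have Mau : M^t* \in unitmx by rewrite adj_unit.
have W1 : W^t* *m W = 1%:M.
  move: E1; rewrite NE mulmx_adj mulmxA => /(can_inj (mulmxK Mu)).
  by rewrite -mulmxA -{1}[M^t*]mulmx1 => /(can_inj (mulKmx Mau))/esym.
have W2 : diagf d = W^t* *m diagf e *m W.
  move: E2; rewrite NE -congdM /congd => /(can_inj (mulmxK Mu)).
  by move=> /(can_inj (mulKmx Mau)).
have WE : W *m diagf d = diagf e *m W.
  by rewrite W2 !mulmxA (mulmx1C W1) mul1mx.
have Wf : W *m diagf (f \o d) = diagf (f \o e) *m W.
  apply/matrixP => i j; move/matrixP/(_ i j): WE.
  rewrite !mul_mx_diag !mul_diag_mx !mxE /=.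
  have [->|Wij] := eqVneq (W i j) 0; first by rewrite !mul0r !mulr0.
  by rewrite mulrC => /(mulIf Wij) ->; rewrite mulrC.
rewrite [in RHS]NE -congdM /congd; congr (_ *m _ *m _).
by rewrite -mulmxA -Wf mulmxA W1 mul1mx.
Qed.

Lemma qform_congd_gt0 M a x : M \in unitmx -> (forall i, 0 < a i) -> x != 0 ->
  0 < qform (congd M a) x.
Proof.
move=> Mu a0 x0; rewrite qform_congd; set y := _ *m _.
have y0 : y != 0.
  apply: contraNneq x0 => /(congr1 (mulmx (invmx M))).
  by rewrite mulmx0 mulKmx // => ->.
have [k yk] : exists k, y k 0 != 0.
  apply/existsP; apply: contraNT y0; rewrite negb_exists => /forallP h.
  by apply/eqP/matrixP => k j; rewrite ord1 [RHS]mxE; exact/eqP/negPn/h.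
rewrite (bigD1 k) //= ltr_wpDr //.
  by apply: sumr_ge0 => j _; rewrite mulr_ge0 ?exprn_ge0 // ltW.
by rewrite mulr_gt0 // exprn_gt0 // normr_gt0.
Qed.

(** At the test vector [invmx N *m delta_mx i 0] the larger form takes the value [d i], while the
    smaller one is positive. *)
Lemma congd_diag_gt0 M N a d : M \in unitmx -> N \in unitmx ->
  (forall i, 0 < a i) -> psd (congd N d - congd M a) -> forall i, 0 < d i.
Proof.
move=> Mu Nu a0 [_ pNM] i; pose x : 'cV[C]_n := invmx N *m delta_mx i 0.
have <- : qform (congd N d) x = d i.
  rewrite -[N]mul1mx -congdM qform_conj mulKVmx //.
  by rewrite qform_delta congd1m diagfE eqxx.
have := pNM x; rewrite -/(qform _ _) qformB subr_ge0; apply: lt_le_trans.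
apply: qform_congd_gt0 => //; apply/negP => /eqP /(congr1 (mulmx N)).
rewrite mulmx0 mulKVmx // => /matrixP/(_ i 0).
by rewrite !mxE !eqxx => /eqP; rewrite oner_eq0.
Qed.

Lemma psdZ c X : 0 <= c -> psd X -> psd (c *: X).
Proof.
move=> c0 [/hermP hX pX]; split.
  apply/hermP; rewrite linearZ /= map_mxZ hX; congr (_ *: _).
  exact/CrealP/ger0_real.
by move=> x; rewrite -scalemxAr -scalemxAl mxE mulr_ge0 ?pX.
Qed.

Lemma psd_scalar c : 0 <= c -> psd c%:M.
Proof.
move=> c0; have -> : c%:M = congd 1%:M (fun=> c).
  by rewrite congd1m; apply/matrixP => i j; rewrite diagfE mxE.
exact: psd_congd.
Qed.

Lemma psd0 : psd 0.
Proof.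
by rewrite -(raddf0 (@scalar_mx C n)); exact: psd_scalar.
Qed.

End CongruenceDiag.

(** * Simultaneous diagonalization of two positive semidefinite matrices *)

Section SimultaneousDiag.
Variables (C : numClosedFieldType) (n : nat).
Implicit Types (M N U V W X Y : 'M[C]_n) (a b d e : 'I_n -> C) (x : 'cV[C]_n).

Lemma psd_diag_ge0 X i : psd X -> 0 <= X i i.
Proof.
by move=> [_ /(_ (delta_mx i 0))]; rewrite -/(qform _ _) qform_delta.
Qed.

(** In spectral form [X i i] is a sum of the nonnegative terms [s k * |U k i|^2]. All of them
    vanish, and with them every term of [X i j]. *)
Lemma psd_diag_eq0 X i j : psd X -> X i i = 0 -> X i j = 0.
Proof.
move=> pX; have [hX _] := pX; have [_ _ EX] := herm_spectral hX.
have := fun k => psd_spectral_ge0 k pX; move: EX => /=.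
move: (spectralmx X) (spectral_diag X) => U s -> d0.
rewrite !congdE => /psumr_eq0P h; apply: big1 => k _.
have /eqP : s 0 k * ((U k i)^* * U k i) = 0.
  by apply: h => // l _; rewrite mulr_ge0 // [_^*%R * _]mulrC -normCK exprn_ge0.
rewrite [_^*%R * _]mulrC -normCK mulf_eq0 sqrf_eq0 normr_eq0.
by case/orP => /eqP ->; rewrite ?conjC0 ?mul0r ?mulr0.
Qed.

Lemma congd_adjC M d : (congd M d)^t* = congd M (fun k => (d k)^*).
Proof.
rewrite /congd !mulmx_adj trmxCK mulmxA; congr (_ *m _ *m _).
rewrite /diagf tr_diag_mx map_diag_mx; congr diag_mx.
by apply/rowP => i; rewrite !mxE.
Qed.

(* [K + 'i *: L] is normal, and [K] and [L] are its real and imaginary parts. *)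
Lemma commuting_herm_diag (K L : 'M[C]_n) : K \is hermsymmx -> L \is hermsymmx ->
  K *m L = L *m K ->
  exists2 V, V \is unitarymx & exists a b, K = congd V a /\ L = congd V b.
Proof.
move=> /hermP hK /hermP hL KL.
pose X := K + 'i *: L.
have XE : X^t* = K - 'i *: L.
  rewrite /X linearD linearZ /= map_mxD map_mxZ hK hL -scaleNr.
  by congr (_ + _ *: _); exact: conjCi.
have nX : X \is normalmx.
  apply/normalmxP; rewrite XE /X mulmxDl !mulmxBr mulmxBl !mulmxDr.
  by rewrite -!scalemxAl -!scalemxAr KL !opprD !addrA subrK addrK.
have Vu := spectral_unitarymx X.
have EX : X = congd (spectralmx X) (fun k => spectral_diag X 0 k).
  have /orthomx_spectralP {1}-> := nX.
  exact: unitary_diag_congd.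
exists (spectralmx X) => //.
move: EX Vu; move: (spectralmx X) (spectral_diag X) => V s EX Vu.
have two0 : (2 : C) != 0 by rewrite pnatr_eq0.
have KE : K = 2^-1 *: (X + X^t*).
  rewrite XE /X addrACA subrr addr0 scalerDr -scalerDl -div1r -splitr.
  by rewrite scale1r.
have LE : L = (2 * 'i)^-1 *: (X - X^t*).
  rewrite XE /X opprB addrC addrA subrK -scalerDl scalerA -mulr2n -['i *+ 2]mulr_natl.
  by rewrite mulVf ?scale1r // mulf_neq0 // neq0Ci.
exists (fun k => 2^-1 * (s 0 k + (s 0 k)^*)).
exists (fun k => (2 * 'i)^-1 * (s 0 k - (s 0 k)^*)).
by split; [rewrite KE EX congd_adjC congdD congdZ
          |rewrite LE EX congd_adjC congdB congdZ].
Qed.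

(** A congruence turns [A + B] into a diagonal projection [diagf e]. The images [K] and [L] of [A]
    and [B] then sum to this projection, which acts as the identity on [K]; hence they commute and
    share a unitary diagonalization. *)
Lemma simultaneous_diag A B : psd A -> psd B ->
  exists2 M, M \in unitmx & exists a b,
    [/\ A = congd M a, B = congd M b,
        forall i, 0 <= a i & forall i, 0 <= b i].
Proof.
move=> pA pB; have pS := psdD pA pB; have [hS _] := pS.
have [] := herm_spectral hS; have := fun k => psd_spectral_ge0 k pS.
move: (spectralmx _) (spectral_diag _) => /= U s s0 Uu _ SE.
pose e i : C := (s 0 i != 0)%:R.
(* Zero eigenvalues of [A + B] are replaced by 1, which keeps [Q] invertible; [e] records where they
   were. *)
pose r i := sqrtC (if s 0 i == 0 then 1 else s 0 i).
have r0 i : r i != 0.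
  by rewrite sqrtC_eq0; case: ifPn => // _; rewrite oner_eq0.
have rr i : r i \is Num.real.
  by rewrite ger0_real // sqrtC_ge0; case: ifP => // _; rewrite ler01.
pose Q := diagf r *m U.
have Qu : Q \in unitmx by rewrite unitmx_mul diagf_unit ?unitarymx_unit.
have SQ : A + B = congd Q e.
  rewrite SE congd_diagf //; apply: eq_congd => i; rewrite sqrtCK /e.
  by case: eqVneq => [->|]; rewrite ?mulr0 ?mulr1.
clearbody Q.
pose P := invmx Q.
have back X : X = Q^t* *m (P^t* *m X *m P) *m Q.
  by rewrite /P !mulmxA -mulmx_adj mulVmx // trmx1 map_mx1 mul1mx mulmxKV.
pose K := P^t* *m A *m P; pose L := P^t* *m B *m P.
have pK : psd K := psd_conj P pA.
have pL : psd L := psd_conj P pB.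
have KL : K + L = diagf e.
  by rewrite -mulmxDl -mulmxDr SQ congdM mulmxV // congd1m.
(* Where [e i = 0], the nonnegative diagonal entries of [K] and [L] add up to 0, so row [i] of [K]
   vanishes. *)
have eK : diagf e *m K = K.
  apply/matrixP => i j; rewrite mul_diag_mx mxE [X in X * _]mxE.
  have [si|] := eqVneq (s 0 i) 0; last by rewrite /e => ->; rewrite mul1r.
  rewrite (@psd_diag_eq0 K i j) ?mulr0 //.
  have /matrixP/(_ i i) := KL; rewrite diagfE eqxx /e si eqxx mxE /= => /eqP.
  by rewrite paddr_eq0 ?psd_diag_ge0 // => /andP[/eqP].
have Ke : K *m diagf e = K.
  have [/hermP hK _] := pK.
  rewrite -[RHS]hK -[in RHS]eK mulmx_adj hK diagf_adj // => i.
  exact: realn.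
have comm : K *m L = L *m K.
  have -> : L = diagf e - K by rewrite -KL addrC addKr.
  by rewrite mulmxBr mulmxBl eK Ke.
have [V Vu [a [b [KE LE]]]] := commuting_herm_diag pK.1 pL.1 comm.
exists (V *m Q); first by rewrite unitmx_mul Qu unitarymx_unit.
exists a, b; split.
- by rewrite -congdM -KE -back.
- by rewrite -congdM -LE -back.
- by move=> i; rewrite -(qform_diag_eigen a i Vu) -KE; exact: pK.2.
- by move=> i; rewrite -(qform_diag_eigen b i Vu) -LE; exact: pL.2.
Qed.

End SimultaneousDiag.

(** * Monotonicity of the geometric mean *)

Section Monotonicity.
Variables (C : numClosedFieldType) (n : nat).
Implicit Types (M N P X T G : 'M[C]_n) (a b d r t : 'I_n -> C) (x : 'cV[C]_n).

(** For an eigenvector [v] of [G] with eigenvalue [s], the form of [T G + G T] at [v] is [2 s] times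
    that of [T], which is positive; hence [s >= 0]. *)
Lemma psd_lyapunov T G : G \is hermsymmx ->
  (forall x, x != 0 -> 0 < qform T x) -> psd (T *m G + G *m T) -> psd G.
Proof.
move=> hG T0 [_ pTG]; have [] := herm_spectral hG.
move: (spectralmx _) (spectral_diag _) => /= U s Uu sr GE.
rewrite GE; apply: psd_congd => i.
pose v := U^t* *m delta_mx i 0 : 'cV[C]_n.
have Gv : G *m v = s 0 i *: v.
  rewrite GE /congd /v !mulmxA mulmxtVK // -mulmxA /diagf scalemxAr.
  congr (_ *m _); apply/matrixP => k l; rewrite mul_diag_mx !mxE.
  by case: eqVneq => [->|]; rewrite ?mulr0.
have v0 : v != 0.
  apply/negP => /eqP /(congr1 (mulmx U)).
  rewrite mulmx0 mulmxA (unitarymxP Uu) mul1mx => /matrixP/(_ i 0).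
  by rewrite !mxE !eqxx => /eqP; rewrite oner_eq0.
have vG : v^t* *m G = s 0 i *: v^t*.
  have /hermP hG' := hG; rewrite -{1}hG' -mulmx_adj Gv linearZ /= map_mxZ.
  by congr (_ *: _); exact/CrealP.
clearbody v.
have := pTG v; rewrite -/(qform _ _) qformD {1 2}/qform.
rewrite !mulmxA vG -[_ *m G *m v]mulmxA Gv -!scalemxAl -scalemxAr.
rewrite mxE -/(qform T v) -mulr2n.
by rewrite pmulrn_lge0 // pmulr_lge0 // T0.
Qed.

(* With [Z = diagf (sqrtC a) P T - diagf (sqrtC b) P] and [G = T - congd P r],
   [T G + G T = Z^* Z + T (1 - congd P a) T + (T^2 - congd P b)]. *)
Lemma congd_geomean_le_diag P a b r t : (forall i, 0 < t i) ->
  (forall i, 0 <= a i) -> (forall i, 0 <= b i) -> (forall i, 0 <= r i) ->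
  (forall i, r i ^+ 2 = a i * b i) ->
  psd (1%:M - congd P a) -> psd (diagf (fun i => t i ^+ 2) - congd P b) ->
  psd (diagf t - congd P r).
Proof.
move=> t0 a0 b0 r0 rab pA pB.
have tr i : t i \is Num.real by rewrite ger0_real ?ltW.
set T := diagf t; set A := congd P a in pA; set B := congd P b in pB.
have hT : T^t* = T by exact: diagf_adj.
have T2 : diagf (fun i => t i ^+ 2) = T *m T.
  by rewrite diagfM; congr diagf; apply/funext => i; rewrite expr2.
pose c i := sqrtC (a i); pose s i := sqrtC (b i).
have cr i : c i \is Num.real by rewrite ger0_real // sqrtC_ge0.
have sr i : s i \is Num.real by rewrite ger0_real // sqrtC_ge0.
have cs i : c i * s i = r i.
  rewrite /c /s -rootCMl // -rab sqrCK //.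
pose Z := diagf c *m P *m T - diagf s *m P.
apply: (@psd_lyapunov T).
- apply/hermP; rewrite linearB /= map_mxB hT congd_adj // => i.
  by rewrite ger0_real.
- by move=> x; rewrite /T -congd1m; apply: qform_congd_gt0 => //; exact: unitmx1.
have -> : T *m (T - congd P r) + (T - congd P r) *m T =
    Z^t* *m Z + T *m (1%:M - A) *m T + (diagf (fun i => t i ^+ 2) - B).
  have AE : A = P^t* *m diagf c *m diagf c *m P.
    rewrite /A /congd -[_ *m diagf c *m diagf c]mulmxA diagfM.
    by congr (_ *m diagf _ *m _); apply/funext => i; rewrite -expr2 sqrtCK.
  have BE : B = P^t* *m diagf s *m diagf s *m P.
    rewrite /B /congd -[_ *m diagf s *m diagf s]mulmxA diagfM.
    by congr (_ *m diagf _ *m _); apply/funext => i; rewrite -expr2 sqrtCK.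
  have RE : congd P r = P^t* *m diagf c *m diagf s *m P.
    rewrite /congd -[_ *m diagf c *m diagf s]mulmxA diagfM.
    by congr (_ *m diagf _ *m _); apply/funext => i; rewrite cs.
  have RE' : congd P r = P^t* *m diagf s *m diagf c *m P.
    rewrite /congd -[_ *m diagf s *m diagf c]mulmxA diagfM.
    by congr (_ *m diagf _ *m _); apply/funext => i; rewrite mulrC cs.
  have ZE : Z^t* *m Z = T *m A *m T + B - T *m congd P r - congd P r *m T.
    have -> : Z^t* = T *m P^t* *m diagf c - P^t* *m diagf s.
      by rewrite /Z linearB /= map_mxB !mulmx_adj hT !diagf_adj // mulmxA.
    rewrite /Z mulmxBl !mulmxBr {1}RE RE' AE BE !mulmxA.
    by rewrite opprB addrACA addrA.
  rewrite ZE T2 !(mulmxBl, mulmxBr) mulmx1 -[RHS]addrA [in RHS](addrACA (T *m T)).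
  rewrite -[in RHS]opprD -[_ + B - _ - _]addrA -[in RHS]opprD.
  rewrite [RHS]addrC [RHS]addrA subrK.
  by rewrite opprD [RHS]addrACA.
apply: psdD; first apply: psdD.
- by rewrite -congd1; exact: psd_congd.
- by rewrite -{1}hT; exact: psd_conj.
- exact: pB.
Qed.

(** Absorbing [sqrtC (a' i)] into [N] and conjugating by the inverse makes the first upper matrix
    the identity. The other upper diagonals become [b' / a'] and [r' / a'], and the former is the
    square of the latter, which is the diagonal case. *)
Lemma congd_geomean_le M N a b r a' b' r' : N \in unitmx ->
  (forall i, 0 <= a i) -> (forall i, 0 <= b i) -> (forall i, 0 <= r i) ->
  (forall i, r i ^+ 2 = a i * b i) ->
  (forall i, 0 < a' i) -> (forall i, 0 < r' i) ->
  (forall i, r' i ^+ 2 = a' i * b' i) ->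
  psd (congd N a' - congd M a) -> psd (congd N b' - congd M b) ->
  psd (congd N r' - congd M r).
Proof.
move=> Nu a0 b0 r0 rab a'0 r'0 rab' pA pB.
have a'n0 i : a' i != 0 by rewrite gt_eqF.
pose c i := sqrtC (a' i).
have cr i : c i \is Num.real by rewrite ger0_real // sqrtC_ge0 ltW.
pose N' := diagf c *m N.
have N'u : N' \in unitmx.
  by rewrite unitmx_mul Nu diagf_unit // => i; rewrite sqrtC_eq0.
have cN d : congd N d = congd N' (fun i => d i / a' i).
  by rewrite congd_diagf //; apply: eq_congd => i; rewrite sqrtCK mulrC divfK.
have conj e d : (invmx N')^t* *m (congd N' e - congd M d) *m invmx N' =
    diagf e - congd (M *m invmx N') d.
  by rewrite mulmxBr mulmxBl !congdM mulmxV // congd1m.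
have back e d : congd N' e - congd M d =
    N'^t* *m (diagf e - congd (M *m invmx N') d) *m N'.
  by rewrite mulmxBr mulmxBl congdM mulmxKV // -congd1m congdM mul1mx.
rewrite cN back; apply: psd_conj; apply: (@congd_geomean_le_diag _ a b) => //.
- by move=> i; rewrite divr_gt0.
- move: pA => /(psd_conj (invmx N')); rewrite cN conj.
  rewrite (_ : diagf _ = 1%:M) // -diagf1; congr diagf; apply/funext => i.
  by rewrite divff.
- move: pB => /(psd_conj (invmx N')); rewrite cN conj.
  rewrite (_ : diagf _ = diagf (fun i => (r' i / a' i) ^+ 2)) //.
  congr diagf; apply/funext => i.
  by rewrite expr_div_n rab' expr2 -mulf_div divff // mul1r.
Qed.

Lemma psd_scalar_bound X : psd X -> exists2 c : C, 0 < c & psd (c%:M - X).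
Proof.
move=> pX; have [hX _] := pX; have := fun k => psd_spectral_ge0 k pX.
have [] := herm_spectral hX; move: (spectralmx X) (spectral_diag X) => /= U s.
move=> Uu _ -> s0; have S0 : 0 <= \sum_i s 0 i by exact: sumr_ge0.
(* The sum of the nonnegative eigenvalues dominates each of them; the added 1 keeps the bound
   positive when [X = 0]. *)
exists (1 + \sum_i s 0 i); first by rewrite ltr_pwDl.
have -> : (1 + \sum_i s 0 i)%:M = congd U (fun=> 1 + \sum_i s 0 i).
  transitivity (congd U (fun=> (1 + \sum_i s 0 i) * 1)); last first.
    by apply: eq_congd => i; rewrite mulr1.
  by rewrite -congdZ congd1 -invmx_unitary // mulVmx ?unitarymx_unit // scalemx1.
rewrite congdB; apply: psd_congd => i.
by rewrite (bigD1 i) //= addrCA addrAC subrr add0r addr_ge0 // sumr_ge0.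
Qed.

End Monotonicity.

Local Open Scope complex_scope.

(* Otherwise unification unfolds congruences down to arithmetic in [R[i]]. *)
Opaque congd.

(** * The weighted geometric mean in a common diagonal frame *)

Section WeightedMean.
Variables (R : realType) (n : nat).
Local Notation C := R[i].
Implicit Types (M N U V X Y : 'M[C]_n) (a b d : 'I_n -> R) (x : 'cV[C]_n).

(** Real diagonal values, to which [powR], real limits and real integrals apply directly. *)
Definition rcongd M a : 'M[C]_n := congd M (fun i => (a i)%:C).
Definition wmean a b (nu : R) i : R := wgm (a i) (b i) nu.

Lemma eq_rcongd M a b : a =1 b -> rcongd M a = rcongd M b.
Proof. by move=> ab; apply: eq_congd => i; rewrite ab. Qed.

Lemma rcongd_adj M a : (rcongd M a)^t* = rcongd M a.
Proof. by apply: congd_adj => i; apply/complex_realP; exists (a i). Qed.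

Lemma rcongdM M N a : N^t* *m rcongd M a *m N = rcongd (M *m N) a.
Proof. exact: congdM. Qed.

Lemma rcongd1 M : rcongd M (fun=> 1) = M^t* *m M.
Proof. exact: congd1. Qed.

Lemma rcongdD M a b : rcongd M a + rcongd M b = rcongd M (fun i => a i + b i).
Proof. by rewrite /rcongd congdD; apply: eq_congd => i; rewrite rmorphD. Qed.

Lemma rcongdB M a b : rcongd M a - rcongd M b = rcongd M (fun i => a i - b i).
Proof. by rewrite /rcongd congdB; apply: eq_congd => i; rewrite rmorphB. Qed.

Lemma rcongdZ M (c : R) a : c%:C *: rcongd M a = rcongd M (fun i => c * a i).
Proof. by rewrite /rcongd congdZ; apply: eq_congd => i; rewrite rmorphM. Qed.

Lemma psdmx_rcongd M a : (forall i, 0 <= a i) -> psdmx (rcongd M a).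
Proof. by move=> a0; apply: psd_congd => i; rewrite ler0c. Qed.

Lemma rcongd_diagf M (s : 'I_n -> R) a :
  rcongd (diagf (fun i => (s i)%:C) *m M) a = rcongd M (fun i => s i ^+ 2 * a i).
Proof.
rewrite /rcongd congd_diagf => [|i]; last by apply/complex_realP; exists (s i).
by apply: eq_congd => i; rewrite rmorphM rmorphXn.
Qed.

Lemma rcongd_mul U a b : U \is unitarymx ->
  rcongd U a *m rcongd U b = rcongd U (fun i => a i * b i).
Proof.
move=> Uu; rewrite /rcongd (congd_mul _ _ Uu).
apply: eq_congd => i.
by rewrite rmorphM.
Qed.

Lemma rcongd_fun_uniq M N d e (f : R -> R) : M \in unitmx -> N \in unitmx ->
  rcongd M (fun=> 1) = rcongd N (fun=> 1) -> rcongd M d = rcongd N e ->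
  rcongd M (f \o d) = rcongd N (f \o e).
Proof.
move=> Mu Nu E1 E2.
(* As in [mxfun], [f] is extended to complex arguments through the real part. *)
exact: (@congd_fun_uniq _ _ M N _ _ (fun z => (f (complex.Re z))%:C) Mu Nu E1 E2).
Qed.

(** Hides the decomposition chosen by [spectralmx]: one unitary and one real diagonal serve [X] and
    all functions of [X] at once. *)
Lemma psdmx_spectral X : psdmx X -> exists U (d : 'I_n -> R),
  [/\ U \is unitarymx, forall i, 0 <= d i, X = rcongd U d &
      forall f : R -> R, mxfun f X = rcongd U (f \o d)].
Proof.
move=> pX; have [hX _] := pX; have := fun i => psd_spectral_ge0 i pX.
have [] := herm_spectral hX; rewrite /mxfun.
move: (spectralmx X) (spectral_diag X) => U s Uu sr -> s0.
exists U, (fun i => complex.Re (s 0 i)); split.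
- exact: Uu.
- by move=> i; rewrite -ler0c (RRe_real (sr i)).
- by apply: eq_congd => i; rewrite (RRe_real (sr i)).
- move=> f; rewrite (unitary_diag_congd _ Uu).
  by apply: eq_congd => i; rewrite mxE.
Qed.

Lemma psdmx_simultaneous_diag X Y : psdmx X -> psdmx Y ->
  exists M a b, [/\ M \in unitmx, X = rcongd M a, Y = rcongd M b,
    forall i, 0 <= a i & forall i, 0 <= b i].
Proof.
move=> pX pY; have [M Mu [a [b [-> -> a0 b0]]]] := simultaneous_diag pX pY.
have aE i : (complex.Re (a i))%:C = a i by rewrite RRe_real // ger0_real.
have bE i : (complex.Re (b i))%:C = b i by rewrite RRe_real // ger0_real.
exists M, (fun i => complex.Re (a i)), (fun i => complex.Re (b i)); split.
- exact: Mu.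
- by apply: eq_congd => i; rewrite aE.
- by apply: eq_congd => i; rewrite bE.
- by move=> i; rewrite -ler0c aE.
- by move=> i; rewrite -ler0c bE.
Qed.

Lemma rcongd_diag_gt0 M N a d : M \in unitmx -> N \in unitmx ->
  (forall i, 0 < a i) -> loewner_le (rcongd M a) (rcongd N d) ->
  forall i, 0 < d i.
Proof.
move=> Mu Nu a0 pNM i; rewrite -ltcR.
apply: (@congd_diag_gt0 _ _ M N (fun k => (a k)%:C) (fun k => (d k)%:C) Mu Nu
  _ pNM) => k.
by rewrite ltcR.
Qed.

(* With [H = A^(1/2)] and [A^(-1/2) B A^(-1/2) = V^* diag(c) V], the pair [A, B]
   is diagonalized both by [diag(sqrt a) M], with [1] and [b / a], and by [V H],
   with [1] and [c]; [rcongd_fun_uniq] compares the two. *)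
Lemma geomean_unit_rcongd M a b nu : M \in unitmx ->
  (forall i, 0 < a i) -> (forall i, 0 <= b i) ->
  geomean_unit nu (rcongd M a) (rcongd M b) = rcongd M (wmean a b nu).
Proof.
move=> Mu a0 b0; have [U [d [Uu _ EA fA]]] : exists U (d : 'I_n -> R),
    [/\ U \is unitarymx, forall i, 0 <= d i, rcongd M a = rcongd U d &
      forall f : R -> R, mxfun f (rcongd M a) = rcongd U (f \o d)].
  by apply: psdmx_spectral; apply: psdmx_rcongd => i; exact: ltW.
rewrite /geomean_unit /mxpow !{}fA.
have d0 i : 0 < d i.
  (* The eigenvalues inherit strict positivity from [a] through the reflexive comparison of the
     matrix with itself. *)
  apply: (rcongd_diag_gt0 Mu (unitarymx_unit Uu) a0).
  by rewrite /loewner_le EA subrr; exact: psd0.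
set H := rcongd U _; set G := rcongd U _; set B := rcongd M b.
have HH : H *m H = rcongd M a.
  rewrite (rcongd_mul _ _ Uu) EA; apply: eq_rcongd => i /=.
  by rewrite powRhalf2 // ltW.
have HG : H *m G = 1%:M.
  transitivity (rcongd U (fun=> 1)).
    rewrite (rcongd_mul _ _ Uu); apply: eq_rcongd => i /=.
    by rewrite powRVhalfK.
  by rewrite rcongd1 -invmx_unitary // mulVmx ?unitarymx_unit.
have GH : G *m H = 1%:M by exact: mulmx1C.
have hH : H^t* = H by exact: rcongd_adj.
have hG : G^t* = G by exact: rcongd_adj.
clearbody H G.
have [V [c [Vu c0 EC fC]]] : exists V (c : 'I_n -> R),
    [/\ V \is unitarymx, forall i, 0 <= c i, G *m B *m G = rcongd V c &
      forall f : R -> R, mxfun f (G *m B *m G) = rcongd V (f \o c)].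
  apply: psdmx_spectral; rewrite -{1}hG; apply: psd_conj.
  exact: psdmx_rcongd.
rewrite {}fC -{1}hH rcongdM.
pose s i := Num.sqrt (a i).
pose M' := diagf (fun i => (s i)%:C) *m M.
have s0 i : (s i)%:C != 0.
  by rewrite -[0]/(0%:C) (inj_eq (@complexI R)) sqrtr_eq0 -ltNge.
have M'u : M' \in unitmx by rewrite unitmx_mul Mu diagf_unit.
have [Hu _] := mulmx1_unit HG.
rewrite -(@rcongd_fun_uniq M' (V *m H) (fun i => b i / a i) c (fun y => y `^ nu)).
- rewrite rcongd_diagf; apply: eq_rcongd => i /=.
  rewrite sqr_sqrtr ?ltW // /wmean /wgm powRB ?powRr1 ?ltW //; last first.
    by apply/implyP => _; rewrite gt_eqF.
  rewrite powRM ?invr_ge0 ?(ltW (a0 i)) //.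
  rewrite -powR_inv1 ?(ltW (a0 i)) // -powRrM mulN1r powRN.
  by rewrite mulrA mulrAC.
- exact: M'u.
- by rewrite unitmx_mul unitarymx_unit.
- rewrite [RHS]rcongd1 mulmx_adj hH mulmxA -[_ *m V]mulmxA.
  rewrite -[V^t*]invmx_unitary; last exact: Vu.
  rewrite (mulVmx (unitarymx_unit Vu)) mulmx1 HH.
  rewrite rcongd_diagf; apply: eq_rcongd => i.
  by rewrite mulr1 sqr_sqrtr // ltW.
- rewrite -rcongdM hH -EC !mulmxA HG mul1mx -mulmxA GH mulmx1 rcongd_diagf.
  apply: eq_rcongd => i; rewrite sqr_sqrtr ?ltW // mulrC divfK //.
  by rewrite gt_eqF.
Qed.

End WeightedMean.

Opaque rcongd.

(** * Monotonicity of the weighted mean at all weights in the unit interval *)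

Section WeightedMeanMonotone.
Variables (R : realType) (n : nat).
Local Notation C := R[i].
Implicit Types (M N U V X Y : 'M[C]_n) (a b d : 'I_n -> R) (x : 'cV[C]_n).

Definition sqnorms M x (k : 'I_n) : R :=
  complex.Re ((M *m x) k 0) ^+ 2 + complex.Im ((M *m x) k 0) ^+ 2.

Lemma qform_rcongd M a x :
  qform (rcongd M a) x = (\sum_k a k * sqnorms M x k)%:C.
Proof.
transitivity (\sum_k (a k)%:C * `|(M *m x) k 0| ^+ 2); first exact: qform_congd.
rewrite rmorph_sum; apply: eq_bigr => k _.
by rewrite rmorphM -add_Re2_Im2.
Qed.

(** Turns the Loewner order into real inequalities that are linear in the diagonals, to which limits
    and squeezing apply. *)
Lemma loewner_rcongdP M N a a' :
  loewner_le (rcongd M a) (rcongd N a') <->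
  forall x, \sum_k a k * sqnorms M x k <= \sum_k a' k * sqnorms N x k.
Proof.
split=> [[_ p] x|h].
  have := p x; rewrite -/(qform _ _) qformB !qform_rcongd -rmorphB ler0c.
  by rewrite subr_ge0.
split; first by apply/hermP; rewrite linearB /= map_mxB !rcongd_adj.
by move=> x; rewrite -/(qform _ _) qformB !qform_rcongd -rmorphB ler0c subr_ge0.
Qed.

Local Open Scope classical_set_scope.

Lemma wmean_sum_continuous a b (w : 'I_n -> R) :
  (forall i, 0 < a i) -> (forall i, 0 < b i) ->
  continuous (fun nu => \sum_i wmean a b nu i * w i).
Proof.
move=> a0 b0 nu; apply: cvg_big => [|i _]; first exact: add_continuous.
by apply: cvgM; [exact: wgm_continuous|exact: cvg_cst].
Qed.

Lemma rcongd_wmean0 M a b : (forall i, 0 <= a i) ->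
  rcongd M (wmean a b 0) = rcongd M a.
Proof. by move=> a0; apply: eq_rcongd => i; exact: wgm0. Qed.

Lemma rcongd_wmean1 M a b : (forall i, 0 <= b i) ->
  rcongd M (wmean a b 1) = rcongd M b.
Proof. by move=> b0; apply: eq_rcongd => i; exact: wgm1. Qed.

(** The weights at which the comparison holds include 0 and 1 by hypothesis, are stable under
    midpoints by [congd_geomean_le], and are stable under limits because the forms are continuous in
    the weight. *)
Lemma loewner_wmean M N a b a' b' nu : N \in unitmx ->
  (forall i, 0 < a i) -> (forall i, 0 < b i) ->
  (forall i, 0 < a' i) -> (forall i, 0 < b' i) -> 0 <= nu <= 1 ->
  loewner_le (rcongd M a) (rcongd N a') ->
  loewner_le (rcongd M b) (rcongd N b') ->
  loewner_le (rcongd M (wmean a b nu)) (rcongd N (wmean a' b' nu)).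
Proof.
move=> Nu a0 b0 a'0 b'0 nu01 pA pB.
pose P nu := loewner_le (rcongd M (wmean a b nu)) (rcongd N (wmean a' b' nu)).
have P0 : P 0 by rewrite /P !rcongd_wmean0 // => i; exact: ltW.
have P1 : P 1 by rewrite /P !rcongd_wmean1 // => i; exact: ltW.
have Pmid s t : P s -> P t -> P ((s + t) / 2).
  move=> Ps Pt.
  apply: (congd_geomean_le (M := M) (N := N) _ _ _ _ _ _ _ _ Ps Pt) => //.
  - by move=> i; rewrite ler0c ltW // wgm_gt0.
  - by move=> i; rewrite ler0c ltW // wgm_gt0.
  - by move=> i; rewrite ler0c ltW // wgm_gt0.
  - by move=> i; rewrite -rmorphXn /= wgm_mid // rmorphM.
  - by move=> i; rewrite ltcR wgm_gt0.
  - by move=> i; rewrite ltcR wgm_gt0.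
  - by move=> i; rewrite -rmorphXn /= wgm_mid // rmorphM.
have [u Pu ux] := midpoint_seq P0 P1 Pmid nu01.
apply/loewner_rcongdP => x; rewrite -subr_ge0.
apply: (@cvgr_to_ge _ \oo _ _
  (fun k => \sum_i wmean a' b' (u k) i * sqnorms N x i -
            \sum_i wmean a b (u k) i * sqnorms M x i)).
  apply: cvgB.
    apply: (cvg_comp u (fun nu => \sum_i wmean a' b' nu i * sqnorms N x i) ux).
    exact: wmean_sum_continuous.
  apply: (cvg_comp u (fun nu => \sum_i wmean a b nu i * sqnorms M x i) ux).
  exact: wmean_sum_continuous.
by near=> k; rewrite subr_ge0; have /loewner_rcongdP := Pu k; apply.
Unshelve. all: by end_near. Qed.

End WeightedMeanMonotone.

(** * The limit defining the mean of singular matrices *)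

Section QuadraticFormLimit.
Variables (R : realType) (n : nat).
Local Notation C := R[i].
Implicit Types (X Y : 'M[C]_n) (x : 'cV[C]_n).

Definition rform X x : R := complex.Re (qform X x).

Lemma ReD (z w : C) : complex.Re (z + w) = complex.Re z + complex.Re w.
Proof. by case: z; case: w. Qed.

(** The entries at [(i, j)] and [(j, i)] are conjugate, so the cross terms of the form add up to
    twice the real part. *)
Lemma herm_Re X i j : X^t* = X -> complex.Re (X i j) =
  (rform X (delta_mx i 0 + delta_mx j 0) - rform X (delta_mx i 0) -
   rform X (delta_mx j 0)) / 2.
Proof.
move=> hX; rewrite /rform qform_deltaD !qform_delta !ReD.
have -> : X j i = (X i j)^*%R by rewrite -[in LHS]hX !mxE.
by case: (X i j) => p q /=; field.
Qed.

(** With the coefficient ['i] the cross terms are ['i] times an entry minus its conjugate, that is,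
    minus twice the imaginary part. *)
Lemma herm_Im X i j : X^t* = X -> complex.Im (X i j) =
  - (rform X (delta_mx i 0 + 'i *: delta_mx j 0) - rform X (delta_mx i 0) -
     rform X (delta_mx j 0)) / 2.
Proof.
move=> hX; rewrite /rform qform_deltaDi !qform_delta !ReD -complexiE.
have -> : X j i = (X i j)^*%R by rewrite -[in LHS]hX !mxE.
case: (X i j) => p q; case: (X i i) => s1 s2; case: (X j j) => t1 t2 /=.
by field.
Qed.

Local Open Scope classical_set_scope.

(** Polarization writes each entry as a fixed combination of values of the form, so convergence of
    the forms gives convergence of the entries. *)
Lemma limmx0_herm (F : R -> 'M[C]_n) X : X^t* = X ->
  (forall e, 0 < e -> (F e)^t* = F e) ->
  (forall x, rform (F e) x @[e --> 0^'+] --> rform X x) ->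
  limmx0 F = X.
Proof.
move=> hX hF FX; apply/matrixP => i j; rewrite mxE.
have ReF : complex.Re (F e i j) @[e --> 0^'+] --> complex.Re (X i j).
  rewrite (herm_Re _ _ hX).
  apply: (@cvg_trans _ ((rform (F e) (delta_mx i 0 + delta_mx j 0) -
   rform (F e) (delta_mx i 0) -
   rform (F e) (delta_mx j 0)) / 2 @[e --> 0^'+])).
    apply: near_eq_cvg; near=> e; rewrite (herm_Re _ _ (hF e _)) //.
  by apply: cvgM; [apply: cvgB; [apply: cvgB|]|exact: cvg_cst]; exact: FX.
have ImF : complex.Im (F e i j) @[e --> 0^'+] --> complex.Im (X i j).
  rewrite (herm_Im _ _ hX).
  apply: (@cvg_trans _ (- (rform (F e) (delta_mx i 0 + 'i *: delta_mx j 0) -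
   rform (F e) (delta_mx i 0) -
   rform (F e) (delta_mx j 0)) / 2 @[e --> 0^'+])).
    apply: near_eq_cvg; near=> e; rewrite (herm_Im _ _ (hF e _)) //.
  apply: cvgM; last exact: cvg_cst.
  by apply: cvgN; apply: cvgB; [apply: cvgB|]; exact: FX.
rewrite (cvg_lim _ ReF) // (cvg_lim _ ImF) //.
by case: (X i j).
Unshelve. all: by end_near. Qed.

End QuadraticFormLimit.

(** * Squeezing the regularized means *)

Section GeomeanLimit.
Variables (R : realType) (n : nat).
Local Notation C := R[i].
Implicit Types (M N X Y : 'M[C]_n) (a b : 'I_n -> R) (x : 'cV[C]_n).

Lemma rform_rcongd M a x : rform (rcongd M a) x = \sum_k a k * sqnorms M x k.
Proof. by rewrite /rform qform_rcongd. Qed.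

Lemma psdmx_real_bound X : psdmx X -> exists2 c : R, 0 < c & psdmx ((c%:C)%:M - X).
Proof.
move=> /psd_scalar_bound[c c0 pc]; exists (complex.Re c).
  by rewrite -ltcR RRe_real // ger0_real // ltW.
by rewrite RRe_real // ger0_real // ltW.
Qed.

(** The shift by [e] is in general not diagonal in the frame [M], so it is bounded by multiples of
    [M^* M]. If [M^* M <= c] then [M^* M / c <= 1]; if the same product for [invmx M] is at most
    [d], congruence by [M] gives [1 <= d M^* M]. *)
Lemma shift_sandwich M : M \in unitmx -> exists c1 c2 : R,
  [/\ 0 < c1, 0 < c2 & forall (a : 'I_n -> R) (e : R), 0 < e ->
    loewner_le (rcongd M (fun i => a i + e * c1)) (rcongd M a + (e%:C)%:M) /\
    loewner_le (rcongd M a + (e%:C)%:M) (rcongd M (fun i => a i + e * c2))].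
Proof.
move=> Mu.
have pM : psdmx (M^t* *m M) by rewrite -rcongd1; exact: psdmx_rcongd.
have [c c0 pc] := psdmx_real_bound pM.
have pV : psdmx ((invmx M)^t* *m invmx M) by rewrite -rcongd1; exact: psdmx_rcongd.
have [d d0 pd] := psdmx_real_bound pV.
exists c^-1, d; split; [by rewrite invr_gt0|exact: d0|move=> a e e0].
have scalarE (y : R) : (fun i => a i + e * y) = (fun i => a i + e * y * 1).
  by apply/funext => i; rewrite mulr1.
split; rewrite /loewner_le scalarE -rcongdD -rcongdZ rcongd1.
  have -> : rcongd M a + (e%:C)%:M - (rcongd M a + (e * c^-1)%:C *: (M^t* *m M)) =
      (e * c^-1)%:C *: ((c%:C)%:M - M^t* *m M).
    rewrite opprD addrACA subrr add0r scalerBr scale_scalar_mx -rmorphM.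
    by rewrite divfK // gt_eqF.
  apply: psdZ; [by rewrite ler0c divr_ge0 // ltW|exact: pc].
have -> : rcongd M a + (e * d)%:C *: (M^t* *m M) - (rcongd M a + (e%:C)%:M) =
    e%:C *: (M^t* *m ((d%:C)%:M - (invmx M)^t* *m invmx M) *m M).
  have key : M^t* *m ((invmx M)^t* *m invmx M) *m M = 1%:M.
    rewrite -!mulmxA (mulVmx Mu) mulmx1 -mulmx_adj (mulVmx Mu).
    by rewrite trmx1 map_mx1.
  rewrite opprD addrACA subrr add0r mulmxBr mulmxBl key.
  by rewrite scalerBr scalemx1 mul_mx_scalar -scalemxAl scalerA -rmorphM.
by apply: psdZ; [rewrite ler0c ltW|exact: psd_conj].
Qed.

Local Open Scope classical_set_scope.

Lemma wmean_shift_cvg a b (w : 'I_n -> R) c nu : 0 < c -> 0 <= nu <= 1 ->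
  (forall i, 0 <= a i) -> (forall i, 0 <= b i) ->
  \sum_k wmean (fun i => a i + e * c) (fun i => b i + e * c) nu k * w k
    @[e --> 0^'+] --> \sum_k wmean a b nu k * w k.
Proof.
move=> c0 /andP[nu0 nu1] a0 b0.
apply: cvg_big => [|i _]; first exact: add_continuous.
apply: cvgM; last exact: cvg_cst.
by apply: cvgM; apply: powR_shift_cvg; rewrite // subr_ge0.
Qed.

(** [X] and [Y] have a common frame [P] of their own, with diagonals made positive by the lower
    bounds. The formula for the mean holds there, and monotonicity applies once on each side. *)
Lemma geomean_unit_sandwich M N (a b a' b' : 'I_n -> R) X Y nu :
  M \in unitmx -> N \in unitmx -> psdmx X -> psdmx Y -> 0 <= nu <= 1 ->
  (forall i, 0 < a i) -> (forall i, 0 < b i) ->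
  (forall i, 0 < a' i) -> (forall i, 0 < b' i) ->
  loewner_le (rcongd M a) X -> loewner_le (rcongd M b) Y ->
  loewner_le X (rcongd N a') -> loewner_le Y (rcongd N b') ->
  exists P d, [/\ geomean_unit nu X Y = rcongd P d,
    loewner_le (rcongd M (wmean a b nu)) (rcongd P d) &
    loewner_le (rcongd P d) (rcongd N (wmean a' b' nu))].
Proof.
move=> Mu Nu pX pY nu01 a0 b0 a'0 b'0.
have [P [c [d [Pu -> -> c0 d0]]]] := psdmx_simultaneous_diag pX pY.
move=> lX lY uX uY; exists P, (wmean c d nu).
have cp := rcongd_diag_gt0 Mu Pu a0 lX.
have dp := rcongd_diag_gt0 Mu Pu b0 lY.
split; first exact: geomean_unit_rcongd.
  exact: (loewner_wmean Pu a0 b0 cp dp nu01 lX lY).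
exact: (loewner_wmean Nu cp dp a'0 b'0 nu01 uX uY).
Qed.

Lemma geomean_rcongd M a b nu : M \in unitmx ->
  (forall i, 0 <= a i) -> (forall i, 0 <= b i) -> 0 <= nu <= 1 ->
  geomean nu (rcongd M a) (rcongd M b) = rcongd M (wmean a b nu).
Proof.
move=> Mu a0 b0 nu01; rewrite /geomean; case: ifPn => [Au|_].
  apply: geomean_unit_rcongd => // i; rewrite lt_neqAle a0 andbT eq_sym.
  (* Invertibility makes the nonnegative diagonal of the first matrix strictly positive. *)
  have := congd_unit_neq0 i Au.
  by rewrite -[0]/(0%:C) (inj_eq (@complexI R)).
have [c1 [c2 [c10 c20 sand]]] := shift_sandwich Mu.
(* The frame [N] of the regularized pair varies with [e], but both bounds stay in the fixed frame
   [M]. *)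
have step e : 0 < e -> exists N d,
   [/\ geomean_unit nu (rcongd M a + (e%:C)%:M) (rcongd M b + (e%:C)%:M) =
       rcongd N d,
    loewner_le
      (rcongd M (wmean (fun i => a i + e * c1) (fun i => b i + e * c1) nu))
      (rcongd N d) &
    loewner_le (rcongd N d)
      (rcongd M (wmean (fun i => a i + e * c2) (fun i => b i + e * c2) nu))].
  move=> e0; have [lA uA] := sand a e e0; have [lB uB] := sand b e e0.
  have pe : psdmx ((e%:C)%:M : 'M[C]_n) by apply: psd_scalar; rewrite ler0c ltW.
  have sh0 (c y : R) : 0 < c -> 0 <= y -> 0 < y + e * c.
    by move=> c0 y0; rewrite ltr_wpDl // mulr_gt0.
  apply: (geomean_unit_sandwich Mu Mu (psdD (psdmx_rcongd M a0) pe)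
    (psdD (psdmx_rcongd M b0) pe) nu01 _ _ _ _ lA lB uA uB) => i; exact: sh0.
apply: limmx0_herm => [|e e0|x].
- exact: rcongd_adj.
- by have [N [d [-> _ _]]] := step e e0; exact: rcongd_adj.
rewrite rform_rcongd.
apply: (@squeeze_cvgr _ _ _ _
  (fun e => \sum_k wmean (fun i => a i + e * c1) (fun i => b i + e * c1) nu k *
    sqnorms M x k)
  (fun e => \sum_k wmean (fun i => a i + e * c2) (fun i => b i + e * c2) nu k *
    sqnorms M x k)); last 2 first.
- exact: wmean_shift_cvg.
- exact: wmean_shift_cvg.
near=> e; have [|N [d [-> lo hi]]] := step e; first by [].
rewrite rform_rcongd; apply/andP; split.
  by move/loewner_rcongdP: lo; apply.
by move/loewner_rcongdP: hi; apply.
Unshelve. all: by end_near. Qed.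

End GeomeanLimit.

(** * The entrywise integral *)

Section MatrixIntegral.
Variables (R : realType) (n : nat).
Local Notation C := R[i].
Local Notation mu := (@lebesgue_measure R).
Local Open Scope classical_set_scope.

Lemma integrable_Rsum (I : Type) (s : seq I) (D : set R) (f : I -> R -> R) :
  measurable D -> (forall k, mu.-integrable D (EFin \o f k)) ->
  mu.-integrable D (EFin \o (fun x => \sum_(k <- s) f k x)).
Proof.
move=> mD fi.
rewrite (_ : _ \o _ = fun x => (\sum_(k <- s) (EFin \o f k) x)%E).
  exact: integrable_sum.
by apply/funext => x /=; rewrite sumEFin.
Qed.

Lemma Rintegral_sum (I : Type) (s : seq I) (D : set R) (f : I -> R -> R) :
  measurable D -> (forall k, mu.-integrable D (EFin \o f k)) ->
  \int[mu]_(x in D) (\sum_(k <- s) f k x) = \sum_(k <- s) \int[mu]_(x in D) f k x.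
Proof.
move=> mD fi; elim: s => [|k s IH].
  rewrite big_nil (@eq_Rintegral _ _ _ mu _ (cst 0)) => [|x _]; last by rewrite big_nil.
  by rewrite Rintegral_cst // mul0r.
rewrite big_cons -IH -RintegralD //; last exact: integrable_Rsum.
by apply: eq_Rintegral => x _; rewrite big_cons.
Qed.

Lemma integral_wgm_sum (a b w : 'I_n -> R) :
  (forall i, 0 <= a i) -> (forall i, 0 <= b i) ->
  \int[mu]_(nu in `[0, 1]) (\sum_k wgm (a k) (b k) nu * w k) =
  \sum_k (\int[mu]_(nu in `[0, 1]) wgm (a k) (b k) nu) * w k.
Proof.
move=> a0 b0; have fi k := integrable_powR_mean (a0 k) (b0 k).
rewrite Rintegral_sum // => [|k].
  apply: eq_bigr => k _; rewrite mulrC -RintegralZl //.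
  by apply: eq_Rintegral => nu _; rewrite mulrC.
rewrite (_ : _ \o _ = fun x => ((w k)%:E * (EFin \o wgm (a k) (b k)) x)%E).
  by apply: integrableZl => //; exact: fi.
by apply/funext => x /=; rewrite -EFinM mulrC.
Qed.

(** The weight of the [k]-th diagonal value in the entry [(i, j)] of [rcongd M]. *)
Definition outer_coef (M : 'M[C]_n) (i j k : 'I_n) : C := (M k i)^*%R * M k j.

Lemma Re_rcongd M a i j : complex.Re (rcongd M a i j) =
  \sum_k a k * complex.Re (outer_coef M i j k).
Proof.
have -> : rcongd M a i j = \sum_k (a k)%:C * outer_coef M i j k by exact: congdE.
have Re0 : complex.Re (0 : C) = 0 by [].
rewrite (big_morph _ (@ReD R) Re0); apply: eq_bigr => k _.
by case: (outer_coef M i j k) => p q /=; rewrite mul0r subr0.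
Qed.

Lemma Im_rcongd M a i j : complex.Im (rcongd M a i j) =
  \sum_k a k * complex.Im (outer_coef M i j k).
Proof.
have -> : rcongd M a i j = \sum_k (a k)%:C * outer_coef M i j k by exact: congdE.
have ImD (z w : C) : complex.Im (z + w) = complex.Im z + complex.Im w.
  by case: z; case: w.
have Im0 : complex.Im (0 : C) = 0 by [].
rewrite (big_morph _ ImD Im0); apply: eq_bigr => k _.
by case: (outer_coef M i j k) => p q /=; rewrite mul0r addr0.
Qed.

(** In the fixed frame [M] every entry is a linear combination of the scalar means, with
    coefficients independent of the weight, so integration acts on the diagonal. *)
Lemma mxintegral01_geomean M (a b : 'I_n -> R) : M \in unitmx ->
  (forall i, 0 <= a i) -> (forall i, 0 <= b i) ->
  mxintegral01 (fun nu => geomean nu (rcongd M a) (rcongd M b)) =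
  rcongd M (fun k => \int[mu]_(nu in `[0, 1]) wgm (a k) (b k) nu).
Proof.
move=> Mu a0 b0; apply/matrixP => i j; rewrite mxE.
apply/eqP; rewrite eq_complex /= Re_rcongd Im_rcongd -!integral_wgm_sum //.
apply/andP; split; apply/eqP; apply: eq_Rintegral => nu.
  rewrite inE /= in_itv /= => nu01.
  by rewrite (geomean_rcongd Mu a0 b0 nu01) Re_rcongd.
rewrite inE /= in_itv /= => nu01.
by rewrite (geomean_rcongd Mu a0 b0 nu01) Im_rcongd.
Qed.

Lemma loewner_rcongd M (a b : 'I_n -> R) : (forall i, a i <= b i) ->
  loewner_le (rcongd M a) (rcongd M b).
Proof.
move=> ab; rewrite /loewner_le rcongdB; apply: psdmx_rcongd => i.
by rewrite subr_ge0.
Qed.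

(** Fits the rightmost bound of the theorem; the next lemma fits the middle one. *)
Lemma rcongd_comb3 (M : 'M[C]_n) (c d e : R) (a b x : 'I_n -> R) :
  c%:C *: (d%:C *: (rcongd M a + rcongd M b) + e%:C *: rcongd M x) =
  rcongd M (fun i => c * (d * (a i + b i) + e * x i)).
Proof. by rewrite rcongdD !rcongdZ rcongdD rcongdZ. Qed.

Lemma rcongd_comb4 (M : 'M[C]_n) (c d e : R) (a b x y : 'I_n -> R) :
  c%:C *: (d%:C *: (rcongd M a + rcongd M b) + e%:C *: (rcongd M x + rcongd M y)) =
  rcongd M (fun i => c * (d * (a i + b i) + e * (x i + y i))).
Proof. by rewrite -rcongd_comb3 -rcongdD. Qed.

End MatrixIntegral.

Theorem proposition4p1 (R : realType) (n : nat) (A B : 'M[R[i]]_n)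
    (hA : psdmx A) (hB : psdmx B) :
  loewner_le
    (mxintegral01 (fun nu : R => geomean nu A B))
    ((1 / 4) *: ((1 / 2) *: (A + B)
       + (3 / 2) *: (geomean (2 / 3) A B + geomean (1 / 3) A B)))
  /\
  loewner_le
    ((1 / 4) *: ((1 / 2) *: (A + B)
       + (3 / 2) *: (geomean (2 / 3) A B + geomean (1 / 3) A B)))
    ((1 / 2) *: ((1 / 2) *: (A + B) + 2 *: geomean (1 / 2) A B)).
Proof.
have [M [a [b [Mu -> -> a0 b0]]]] := psdmx_simultaneous_diag hA hB.
(* The complex scalars are rewritten as images of real ones, so that they act on real diagonals. *)
have qE (p q : nat) : (p%:R / q%:R : R[i]) = ((p%:R / q%:R : R)%:C)%C.
  by rewrite fmorph_div !rmorph_nat.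
rewrite (mxintegral01_geomean Mu a0 b0).
rewrite !(geomean_rcongd Mu a0 b0); try lra.
rewrite (qE 1 4) (qE 1 2) (qE 3 2).
rewrite -[2 : R[i]](rmorph_nat (real_complex R)).
rewrite rcongd_comb4 rcongd_comb3.
split; apply: loewner_rcongd => i.
  apply: le_trans (Rintegral_powR_mean_le (a0 i) (b0 i)) _.
  (* The scalar 3/8 rule is exactly the middle expression, so the difference is 0. *)
  by rewrite -subr_ge0 (_ : _ - _ = 0) // /wmean /wgm; field.
by have := powR_means_le (a0 i) (b0 i); rewrite /wmean /wgm; lra.
Qed.
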